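(* A team of $5$ co-located and synchronous agents is sufficient to solve PerpExploration-BBH on a ring $R$ with $n$ nodes under the face-to-face (F2F) model of communication; that is, there is a deterministic algorithm for five agents starting at a common safe node which solves PerpExploration-BBH on every oriented ring in the F2F model.
   Context: Model. $R=\{v_0,\dots,v_{n-1}\}$ is a ring with unlabeled nodes; node $v_i$ has two ports, leading to $v_{(i-1)\bmod n}$ and $v_{(i+1)\bmod n}$, consistently labeled left and right. Agents know $n$, have distinct IDs (from $[0,k^c]$, where $k$ is the number of agents and $c$ a constant), have $O(\log n)$ bits of internal memory, and all run the same deterministic algorithm. ''Co-located'' means that all agents start at one common node, called home. Time proceeds in synchronous rounds; in each round every agent at a node $v$ takes a snapshot (the two ports, its own memory, the IDs of the agents currently at $v$), then performs a communication step and a move step (stay, or move through a port, being at the corresponding neighbour in the next round). Agents crossing the same edge in opposite directions do not notice each other. Face-to-face (F2F) model: agents can exchange messages exactly when they are at the same node in the same round; there are no pebbles and no memory at the nodes. Byzantine black hole. Exactly one node $v_b$ is a Byzantine black hole; all other nodes are safe; its position is fixed and unknown to the agents, and may be any node other than the starting node of the agents. At the beginning of each round an adversary (who knows the algorithm) decides whether $v_b$ is active during that round. If active, all agents at $v_b$ in that round are destroyed without trace. If not active, $v_b$ behaves exactly like a safe node. PerpExploration-BBH: the agents must move so that every node of $R$ except $v_b$ is visited by at least one agent infinitely often. An algorithm solves the problem if this holds for every ring size $n$, every admissible position of $v_b$ and every behaviour of the adversary. *)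

(* Defs.v *)
From mathcomp Require Import all_boot.

Set Implicit Arguments.
Unset Strict Implicit.
Unset Printing Implicit Defensive.

Inductive move := Stay | GoLeft | GoRight.

(* [ord_pred] and [ordS] are the predecessor and the successor modulo [n]. *)
Definition dest n (v : 'I_n) (d : move) : 'I_n :=
  match d with Stay => v | GoLeft => ord_pred v | GoRight => ordS v end.

(* The identifiers available to [k] agents, i.e. the integer interval
   [0, k ^ c]. *)
Definition ident (k c : nat) := 'I_(k ^ c).+1.

Definition memory (b : nat) := b.-tuple bool.

(* What an agent sees before communicating.  The two ports are always left and
   right, so they carry no information; node names and the round number are not
   available.  [seen] contains the identifier of the observer itself. *)
Record snapshot (k c b : nat) := Snapshot {
  own_id : ident k c;
  own_mem : memory b;
  seen : {set ident k c}
}.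

(* The common deterministic algorithm, parameterized by the ring size, which
   the agents know.  [send] is the communication step and [act] the subsequent
   update of the memory and the move.  The inbox given to [act] maps an
   identifier to the message of its bearer, and to [None] when the bearer is
   not on the same node.  The type of messages is unconstrained: a message is
   a function of the snapshot of its sender, so it cannot convey more than
   that, and one simultaneous exchange per round is enough to convey it all. *)
Record algorithm (k c : nat) := Algorithm {
  bits : nat -> nat;
  message : nat -> Type;
  init_mem : forall n, memory (bits n);
  send : forall n, snapshot k c (bits n) -> message n;
  act : forall n, snapshot k c (bits n) -> (ident k c -> option (message n)) ->
    memory (bits n) * move
}.

(* O(log n) bits of memory per agent; [trunc_log 2 n] is positive when
   [1 < n]. *)
Definition log_memory k c (A : algorithm k c) : Prop :=
  exists B : nat, forall n, 1 < n -> bits A n <= B * trunc_log 2 n.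

Section Execution.

Variables (k c : nat) (A : algorithm k c) (n : nat).
Variable ids : 'I_k -> ident k c.

(* The node and the memory of each agent; [None] for a destroyed agent. *)
Definition config := {ffun 'I_k -> option ('I_n * memory (bits A n))}.

Definition located (C : config) (v : 'I_n) (a : 'I_k) : bool :=
  if C a is Some (u, _) then u == v else false.

Definition ids_at (C : config) (v : 'I_n) : {set ident k c} :=
  [set ids a | a in [pred a | located C v a]].

Definition view (C : config) (a : 'I_k) (v : 'I_n) (m : memory (bits A n)) :
    snapshot k c (bits A n) :=
  Snapshot (ids a) m (ids_at C v).

Definition inbox (C : config) (v : 'I_n) (i : ident k c) :
    option (message A n) :=
  if [pick a | located C v a && (ids a == i)] is Some a then
    if C a is Some (_, m) then Some (send (view C a v m)) else None
  else None.

Definition strike (vb : 'I_n) (active : bool) (C : config) : config :=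
  [ffun a => if active && located C vb a then None else C a].

Definition agents_step (C : config) : config :=
  [ffun a => if C a is Some (v, m) then
               let: (m', d) := act (view C a v m) (inbox C v) in
               Some (dest v d, m')
             else None].

Definition round (vb : 'I_n) (active : bool) (C : config) : config :=
  agents_step (strike vb active C).

(* The configuration at the beginning of round [t], before the black hole
   possibly strikes.  As the agents are deterministic, letting the adversary
   choose the rounds of activity adaptively or once and for all yields the same
   executions, so its behaviours are the maps [active : nat -> bool]. *)
Fixpoint config_at (home vb : 'I_n) (active : nat -> bool) (t : nat) : config :=
  if t is t'.+1 then round vb (active t') (config_at home vb active t')
  else [ffun=> Some (home, init_mem A n)].

Definition visited (home vb : 'I_n) (active : nat -> bool) (t : nat)
    (v : 'I_n) : Prop :=
  exists a, located (config_at home vb active t) v a.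

End Execution.

Definition solves_PerpExploration_BBH k c (A : algorithm k c) : Prop :=
  forall (n : nat) (home vb : 'I_n) (ids : 'I_k -> ident k c)
         (active : nat -> bool),
    injective ids -> vb != home ->
    forall v : 'I_n, v != vb ->
    forall T : nat, exists2 t, T <= t & visited A ids home vb active t v.

(* Main.v *)
(* Four agents, called Rear, Back, Fore and Front, advance along the ring in
   cycles of three rounds; the fifth one, Spare, stays at home.  If [x] is the
   current node, the positions at the beginning of the three rounds are

              Rear   Back   Fore   Front
     Gather    x      x      x      x+1
     Advance   x     x+1    x+1     x+1
     Split     x      x     x+2     x+2

   so the next cycle starts at [x+1].  Two properties make this safe as soon as
   the ring has three nodes: the four agents are never all on one node (except
   at home, at the start), and Back and Fore shuttle so that an agent missing
   from a meeting can have died on one node only.  Whenever agents die, within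
   two rounds a survivor therefore either knows where the black hole is, or dies
   and leaves another survivor with the same conclusion.  This survivor then
   goes back and forth along the path formed by the other nodes.  If nobody ever
   reaches a conclusion, the cycles go on forever and visit every node.  On a
   ring of two nodes, Spare does all the work. *)
Require Import Defs.
From HB Require Import structures.
From mathcomp Require Import all_boot zify.

Set Implicit Arguments.
Unset Strict Implicit.
Unset Printing Implicit Defensive.

(** * Roles, phases and the states of an agent *)

Inductive role := Rear | Back | Fore | Front | Spare.

Definition ord_of_role (r : role) : 'I_5 :=
  match r with
  | Rear => @Ordinal 5 0 isT
  | Back => @Ordinal 5 1 isT
  | Fore => @Ordinal 5 2 isT
  | Front => @Ordinal 5 3 isT
  | Spare => @Ordinal 5 4 isT
  end.

Definition role_of_ord (i : 'I_5) : role :=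
  match val i with
  | 0 => Rear | 1 => Back | 2 => Fore | 3 => Front | _ => Spare
  end.

Lemma ord_of_roleK : cancel ord_of_role role_of_ord.
Proof. by case. Qed.

Lemma role_of_ordK : cancel role_of_ord ord_of_role.
Proof. by case=> [[|[|[|[|[|]]]]]] // lt_i5; apply: val_inj. Qed.

HB.instance Definition _ := Finite.copy role (can_type ord_of_roleK).

Inductive phase := Gather | Advance | Split.

Definition code_phase (p : phase) : option bool :=
  match p with Gather => None | Advance => Some false | Split => Some true end.

Definition decode_phase (o : option bool) : phase :=
  match o with None => Gather | Some false => Advance | Some true => Split end.

Lemma code_phaseK : cancel code_phase decode_phase.
Proof. by case. Qed.

HB.instance Definition _ := Finite.copy phase (can_type code_phaseK).

Definition next_phase (p : phase) : phase :=
  match p with Gather => Advance | Advance => Split | Split => Gather end.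

(** The index of a patrol has period [n.-1.*2]; the successor keeps the ordinal type inhabited, as
    [inord] demands. *)
Definition state (n : nat) := option ((role * phase) + 'I_n.*2.+1)%type.

Definition start {n} : state n := None.
Definition walking {n} (r : role) (p : phase) : state n := Some (inl (r, p)).
Definition patrolling {n} (j : nat) : state n := Some (inr (inord j)).

Lemma card_state n : #|{: state n}| <= n.*2 + 17.
Proof.
rewrite card_option card_sum card_prod card_ord.
have := leq_card _ (can_inj ord_of_roleK); rewrite card_ord.
have := leq_card _ (can_inj code_phaseK); rewrite card_option card_bool.
nia.
Qed.

(** * Storing a finite type in bits *)

Section MemoryCoding.

Variables (S : finType) (x0 : S) (b : nat).

Definition encode (x : S) : memory b :=
  nth [tuple of nseq b false] (enum {: memory b}) (enum_rank x).

Definition decode (m : memory b) : S :=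
  nth x0 (enum S) (index m (enum {: memory b})).

Lemma encodeK : #|S| <= 2 ^ b -> cancel encode decode.
Proof.
move=> le_S2b x; rewrite /decode /encode index_uniq ?enum_uniq ?nth_enum_rank //.
by rewrite -cardE card_tuple card_bool (leq_trans (ltn_ord _)).
Qed.

End MemoryCoding.

Definition mem_bits (n : nat) := trunc_log 2 n + 6.

Lemma state_fits n : 0 < n -> #|{: state n}| <= 2 ^ mem_bits n.
Proof.
move=> n_gt0; apply: leq_trans (card_state n) _.
(* [n < 2 * 2 ^ trunc_log 2 n], so the 64-fold power exceeds [32 * n], which is at least
   [n.*2 + 17]. *)
have := trunc_log_ltn n (isT : 1 < 2).
by rewrite /mem_bits expnS expnD (_ : 2 ^ 6 = 64) //; lia.
Qed.

(* The distance from the black hole, counted to the right, of an agent in state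
   [patrolling j]: over the period [n.-1.*2] it takes the values 1, ..., n - 1,
   n - 1, ..., 1. *)
Definition offset (n j : nat) := if j < n.-1 then j.+1 else n.-1.*2 - j.

(** The pause at each end matches the offsets [n.-1] and 1, which occur twice in a row. *)
Definition patrol_move (n j : nat) : move :=
  if j.+1 < n.-1 then GoRight
  else if (j == n.-2) || (j == n.-1.*2.-1) then Stay else GoLeft.

Definition patrol (n j : nat) : state n * move :=
  (patrolling (j.+1 %% n.-1.*2), patrol_move n j).

(* The position of the black hole relative to the node of the observer. *)
Definition hole_here n : state n * move := (patrolling 0, GoRight).
Definition hole_left n : state n * move := (patrolling 0, Stay).
Definition hole_right n : state n * move := (patrolling n.-2, Stay).

(** Co-located agents survive or perish together, so a missing partner is inferred to have died
    where it stood one round earlier. In [Gather], Back came from the left and Fore from the right;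
    in [Advance], Fore came from the left and Front had not moved; in [Split], Back came from the
    right and Rear had not moved. *)
Definition walk n (r : role) (p : phase) (meets : role -> bool) :
    state n * move :=
  let continue d := (walking r (next_phase p), d) in
  match p, r with
  | Gather, Back => if meets Fore then continue GoRight else hole_right n
  | Gather, Fore => if meets Back then continue GoRight else hole_left n
  | Advance, Back => if meets Front then continue GoLeft else hole_here n
  | Advance, Fore => continue GoRight
  | Advance, Front => if meets Fore then continue GoRight else hole_left n
  | Split, Rear => if meets Back then continue GoRight else hole_right n
  | Split, Back => if meets Rear then continue GoRight else hole_here n
  | Split, Fore => continue GoLeft
  | _, _ => continue Stay
  end.

(** * The algorithm and its memory bound *)

Section Algorithm.

Variable c : nat.

(** Identifiers are arbitrary; their ranks in the first round, when all five agents are together,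
    provide the roles. *)
Definition id_rank (i : ident 5 c) (ids : {set ident 5 c}) : nat :=
  #|[set i' in ids | i' < i]|.

Definition meets n (box : ident 5 c -> option (state n)) (r : role) : bool :=
  [exists i, if box i is Some (Some (inl (r', _))) then r' == r else false].

Definition next n (s : state n) (rank : nat) (present : role -> bool) :
    state n * move :=
  match s with
  | None => let r := role_of_ord (inord rank) in
            (walking r Gather, if r == Front then GoRight else Stay)
  | Some (inl (r, p)) => walk n r p present
  | Some (inr j) => patrol n j
  end.

Definition stored n (s : snapshot 5 c (mem_bits n)) : state n :=
  decode start (own_mem s).

Definition explore : algorithm 5 c :=
  @Algorithm 5 c mem_bits state (fun n => encode (mem_bits n) (@start n))
    stored
    (fun n s box =>
       let: (s', d) := next (stored s) (id_rank (own_id s) (seen s)) (meets box)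
       in (encode (mem_bits n) s', d)).

Lemma explore_log_memory : log_memory explore.
Proof.
(* As the logarithm is at least 1, the additive 6 is absorbed by the factor 1 + 6. *)
exists 7 => n n_gt1 /=; rewrite /mem_bits.
have : 0 < trunc_log 2 n by rewrite trunc_log_gt0.
lia.
Qed.

(** * Roles as names of the agents, and configurations described by roles *)

Variables (n' : nat).
Let n := n'.+1.
Variables (home vb : 'I_n) (ids : 'I_5 -> ident 5 c) (active : nat -> bool).
Hypothesis ids_inj : injective ids.
Hypothesis vb_home : vb != home.

Local Notation config := (config explore n).
Local Notation enc s := (encode (mem_bits n) (s : state n)).

Definition role_of (a : 'I_5) : role :=
  role_of_ord (inord (id_rank (ids a) [set ids b | b in 'I_5])).

Lemma id_rank_lt a : id_rank (ids a) [set ids b | b in 'I_5] < 5.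
Proof.
rewrite -[X in _ < X](card_ord 5) -(card_imset 'I_5 ids_inj).
apply: proper_card; apply/properP; split.
  by apply/subsetP=> i; rewrite inE => /andP[].
by exists (ids a); rewrite ?imset_f // inE ltnn andbF.
Qed.

Lemma id_rank_ltW a b : ids a < ids b ->
  id_rank (ids a) [set ids d | d in 'I_5]
    < id_rank (ids b) [set ids d | d in 'I_5].
Proof.
move=> lt_ab; apply: proper_card; apply/properP; split.
  apply/subsetP=> i; rewrite !inE => /andP[-> /=] lt_i; exact: ltn_trans lt_ab.
by exists (ids a); rewrite inE ?imset_f //= ltnn.
Qed.

Lemma role_of_inj : injective role_of.
Proof.
move=> a b /(can_inj role_of_ordK) /(congr1 val) /=.
rewrite !inordK ?id_rank_lt // => eq_rank; apply: ids_inj; apply: val_inj.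
have [lt_ab | lt_ba | //] := ltngtP (ids a) (ids b).
- by have := id_rank_ltW lt_ab; rewrite eq_rank ltnn.
- by have := id_rank_ltW lt_ba; rewrite eq_rank ltnn.
Qed.

Lemma role_of_surj r : exists a, role_of a == r.
Proof.
have ord_role_inj : injective (ord_of_role \o role_of).
  exact: inj_comp (can_inj ord_of_roleK) role_of_inj.
have [a' _ a'K] := injF_bij ord_role_inj.
exists (a' (ord_of_role r)); apply/eqP/(can_inj ord_of_roleK); exact: a'K.
Qed.


Definition agent (r : role) : 'I_5 := xchoose (role_of_surj r).

Lemma agentK r : role_of (agent r) = r.
Proof. exact/eqP/(xchooseP (role_of_surj r)). Qed.

Lemma role_ofK a : agent (role_of a) = a.
Proof. by apply: role_of_inj; rewrite agentK. Qed.

Lemma stored_encode i (s : state n) ids' :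
  stored (Snapshot i (encode (mem_bits n) s) ids') = s.
Proof. exact/encodeK/state_fits. Qed.

(** The ring unrolled from [home], so that positions in cycle [q] need no reduction modulo [n]. *)
Definition node (x : nat) : 'I_n := iter x (@ordS n) home.

Definition stands (C : config) r x p :=
  C (agent r) = Some (node x, enc (walking r p)).

Definition dead (C : config) r := C (agent r) = None.

Definition patrols (C : config) a j :=
  C a = Some (iter (offset n j) (@ordS n) vb, enc (patrolling j)).

Definition solved (C : config) := exists a j, j < n.-1.*2 /\ patrols C a j.

(** This excludes impersonation: the role of a dead agent is never met again. *)
Definition lawful (C : config) := forall a v m, C a = Some (v, m) ->
  match decode (@start n) m with
  | None => false
  | Some (inl (r, _)) => r == role_of a
  | Some (inr _) => true
  end.

Lemma strikeE act (C : config) a v m : C a = Some (v, m) ->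
  strike vb act C a = if act && (v == vb) then None else Some (v, m).
Proof. by move=> Ca; rewrite ffunE /located Ca. Qed.

Lemma strike_dead act (C : config) r : dead C r -> dead (strike vb act C) r.
Proof. by rewrite /dead ffunE => ->; rewrite if_same. Qed.

Lemma round_dead act (C : config) r :
  dead (strike vb act C) r -> dead (round ids vb act C) r.
Proof. by rewrite /dead [round _ _ _ _ _]ffunE => ->. Qed.

Lemma walk_law r p f : match (@walk n r p f).1 with
  | None => false
  | Some (inl (r', _)) => r' == r
  | Some (inr _) => true
  end.
Proof. by case: p; case: r => //=; case: ifP. Qed.

Lemma strike_lawful act C : lawful C -> lawful (strike vb act C).
Proof. by move=> lawC a v m; rewrite ffunE; case: ifP => // _ /lawC. Qed.

Lemma round_lawful act C : lawful C -> lawful (round ids vb act C).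
Proof.
move=> lawC a v m; rewrite ffunE.
case Ca: (strike vb act C a) => [[u mu]|] //=.
have := strike_lawful lawC Ca; rewrite /stored /=.
case: (decode _ mu) => [[[r p]|j]|] //= law_a.
  have := walk_law r p (meets (inbox ids (strike vb act C) u)).
  case: walk => s d /= law_s [_ <-]; rewrite encodeK ?state_fits //.
  by case: s law_s => [[[r' p']|]|] // /eqP->.
by case=> _ <-; rewrite encodeK ?state_fits.
Qed.

Lemma meets_alive (C : config) r x p : stands C r x p ->
  meets (inbox ids C (node x)) r.
Proof.
move=> Cr; apply/existsP; exists (ids (agent r)); rewrite /inbox.
case: pickP => [a /andP[_ /eqP/ids_inj->] | /(_ (agent r))].
  by rewrite Cr /= stored_encode; apply: eqxx.
by rewrite /located Cr !eqxx.
Qed.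

Lemma meets_dead (C : config) r v : lawful C -> dead C r ->
  meets (inbox ids C v) r = false.
Proof.
move=> lawC Cr; apply/existsP=> -[i]; rewrite /inbox.
case: pickP => // a _; case Ca: (C a) => [[u m]|] //.
have := lawC _ _ _ Ca; rewrite /= /stored /=.
case: (decode _ m) => [[[r' p]|]|] // /eqP-> /eqP eq_r.
by move: Cr; rewrite /dead -eq_r role_ofK Ca.
Qed.


Lemma stands_strike (act : bool) (C : config) r x p : stands C r x p ->
  ~~ (act && (node x == vb)) -> stands (strike vb act C) r x p.
Proof. by move=> Cr /negbTE safe; rewrite /stands (strikeE _ Cr) safe. Qed.

Lemma dead_struck (act : bool) (C : config) r x p : stands C r x p -> act -> node x = vb ->
  dead (strike vb act C) r.
Proof. by move=> Cr hit x_vb; rewrite /dead (strikeE _ Cr) hit x_vb eqxx. Qed.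

Lemma round_stands (act : bool) (C : config) r x p : stands (strike vb act C) r x p ->
  round ids vb act C (agent r) =
    let: (s, d) := walk n r p (meets (inbox ids (strike vb act C) (node x))) in
    Some (dest (node x) d, enc s).
Proof.
move=> Cr; rewrite [round _ _ _ _ _]ffunE Cr /= stored_encode /=.
by case: walk.
Qed.

(* In each round, besides the intact formation, only two kinds of losses can go
   undetected; their last component locates [vb].
   Nothing is claimed about the agents that are not mentioned. *)
Definition gather_inv q C : Prop :=
  [\/ [/\ stands C Rear q Gather, stands C Back q Gather,
          stands C Fore q Gather & stands C Front q.+1 Gather],
      [/\ dead C Back, stands C Fore q Gather & node q = ordS vb]
    | [/\ dead C Fore, stands C Back q Gather & node q.+1 = vb]].

Definition advance_inv q C : Prop :=
  [\/ [/\ stands C Rear q Advance, stands C Back q.+1 Advance,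
          stands C Fore q.+1 Advance & stands C Front q.+1 Advance],
      [/\ dead C Fore, stands C Front q.+1 Advance & node q = vb]
    | [/\ dead C Front, stands C Rear q Advance, stands C Back q.+1 Advance
        & node q.+1 = vb]].

Definition split_inv q C : Prop :=
  [\/ [/\ stands C Rear q Split, stands C Back q Split,
          stands C Fore q.+2 Split & stands C Front q.+2 Split],
      [/\ dead C Rear, stands C Back q Split, stands C Fore q.+2 Split
        & node q = vb]
    | [/\ dead C Back, stands C Rear q Split & node q.+1 = vb]].

Hypothesis n_ge3 : 2 < n.

(** * Ring arithmetic and safety of the patrol *)

Lemma iter_ordSE (v : 'I_n) k : iter k (@ordS n) v = (v + k) %% n :> nat.
Proof.
elim: k => [|k IHk] /=; first by rewrite addn0 modn_small.
by rewrite IHk addnS -addn1 modnDml addn1.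
Qed.

Lemma iter_ordS_neq (v : 'I_n) k : 0 < k < n -> iter k (@ordS n) v != v.
Proof.
case/andP=> k_gt0 lt_kn; apply/eqP=> /(congr1 val) /=; rewrite iter_ordSE.
move/eqP; rewrite -[X in _ == X](modn_small (ltn_ord v)).
by rewrite -[X in _ == X %[mod _]]addn0 eqn_modDl mod0n modn_small // gtn_eqF.
Qed.

Lemma ordS_neq (v : 'I_n) : ordS v != v.
Proof. by rewrite (iter_ordS_neq v (k := 1)) // (ltn_trans _ n_ge3). Qed.

Lemma nodeS_neq x : node x.+1 != node x.
Proof. exact: ordS_neq. Qed.

(** With fewer than three nodes, a strike on [node q] in [Split] would also reach Fore on
    [node q.+2]. *)
Lemma nodeSS_neq x : node x.+2 != node x.
Proof. by rewrite (iter_ordS_neq (node x) (k := 2)). Qed.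

Lemma iter_ordSn (v : 'I_n) : iter n (@ordS n) v = v.
Proof.
by apply: val_inj; apply: etrans (iter_ordSE v n) _; rewrite modnDr modn_small.
Qed.

Lemma iter_ordS_pred (v : 'I_n) : iter n.-1 (@ordS n) (ordS v) = v.
Proof. by rewrite -iterSr iter_ordSn. Qed.

Lemma solved_left (C : config) a v : C a = Some (v, enc (patrolling 0)) ->
  v = ordS vb -> solved C.
Proof.
move=> Ca v_vb; exists a, 0; split; first by rewrite double_gt0; lia.
by rewrite /patrols Ca v_vb /offset ifT //; lia.
Qed.

Lemma solved_right (C : config) a v : C a = Some (v, enc (patrolling n.-2)) ->
  ordS v = vb -> solved C.
Proof.
move=> Ca v_vb; exists a, n.-2; split; first by rewrite -addnn; lia.
rewrite /patrols Ca /offset ifT; last by lia.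
by rewrite (_ : n.-2.+1 = n.-1) ?prednK -?v_vb ?iter_ordS_pred //; lia.
Qed.

Lemma offset_gt0 j : j < n.-1.*2 -> 0 < offset n j < n.
Proof. by rewrite /offset; case: ifP; lia. Qed.

Lemma dest_patrol j : j < n.-1.*2 ->
  dest (iter (offset n j) (@ordS n) vb) (patrol_move n j)
    = iter (offset n (j.+1 %% n.-1.*2)) (@ordS n) vb.
Proof.
move=> lt_j; rewrite /patrol_move.
(* The cases are the way out, the pause at the far end, the pause at the near end and the way
   back. *)
have [lt_j1 | le_j1] := ltnP j.+1 n.-1.
  suff -> : offset n (j.+1 %% n.-1.*2) = (offset n j).+1 by rewrite iterS.
  rewrite modn_small; last by lia.
  by rewrite /offset lt_j1 (ltnW lt_j1).
have [-> | neq_mid] := eqVneq j n.-2.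
  suff -> : offset n (n.-2.+1 %% n.-1.*2) = offset n n.-2 by [].
  rewrite modn_small; last by lia.
  by rewrite /offset; do 2!case: ifP; lia.
have [-> | neq_last] := eqVneq j n.-1.*2.-1.
  suff -> : offset n (n.-1.*2.-1.+1 %% n.-1.*2) = offset n n.-1.*2.-1 by [].
  rewrite prednK ?modnn; last by lia.
  by rewrite /offset; do 2!case: ifP; lia.
suff -> : offset n j = (offset n (j.+1 %% n.-1.*2)).+1.
  by rewrite iterS /= ordSK.
rewrite modn_small; last by lia.
by rewrite /offset; do 2!case: ifP; lia.
Qed.

Lemma round_patrols (act : bool) (C : config) a j : j < n.-1.*2 ->
  patrols C a j -> patrols (round ids vb act C) a (j.+1 %% n.-1.*2).
Proof.
move=> lt_j Ca; rewrite /patrols [round _ _ _ _ _]ffunE (strikeE _ Ca).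
rewrite (negbTE (iter_ordS_neq _ (offset_gt0 lt_j))) andbF /= stored_encode /=.
by rewrite inordK ?dest_patrol //; lia.
Qed.


(** * One round of each phase *)

Section Rounds.

Variables (act : bool) (C : config) (q : nat).
Hypothesis lawC : lawful C.

Let lawD : lawful (strike vb act C) := strike_lawful lawC.

Lemma safe_ne x : node x != vb -> ~~ (act && (node x == vb)).
Proof. by move/negbTE->; rewrite andbF. Qed.

Lemma gather_step : gather_inv q C ->
  solved (round ids vb act C) \/ advance_inv q (round ids vb act C).
Proof.
case=> [[CR CB CF CT] | [deadB CF vb_q] | [deadF CB vb_q]].
(* A strike on [node q] leaves Front, who will miss Fore; one on [node q.+1] kills Front, whom Back
   will miss. *)
- have [/andP[hit /eqP vb_q] | safe0] := boolP (act && (node q == vb)).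
    right; apply: Or32; split=> //.
      exact/round_dead/(dead_struck CF).
    have safe1: ~~ (act && (node q.+1 == vb)) by rewrite safe_ne -?vb_q ?nodeS_neq.
    by rewrite /stands (round_stands (stands_strike CT safe1)).
  have DB := stands_strike CB safe0; have DF := stands_strike CF safe0.
  have CR' : stands (round ids vb act C) Rear q Advance.
    by rewrite /stands (round_stands (stands_strike CR safe0)).
  have CB' : stands (round ids vb act C) Back q.+1 Advance.
    by rewrite /stands (round_stands DB) /= (meets_alive DF).
  have CF' : stands (round ids vb act C) Fore q.+1 Advance.
    by rewrite /stands (round_stands DF) /= (meets_alive DB).
  have [/andP[hit /eqP vb_q1] | safe1] := boolP (act && (node q.+1 == vb)).
    right; apply: Or33; split=> //.
    exact/round_dead/(dead_struck CT).
  right; apply: Or31; split=> //.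
  by rewrite /stands (round_stands (stands_strike CT safe1)).
- left; have safe0: ~~ (act && (node q == vb)).
    by rewrite safe_ne // vb_q ordS_neq.
  apply: (solved_left (a := agent Fore) _ vb_q).
  rewrite (round_stands (stands_strike CF safe0)) /=.
  by rewrite (meets_dead _ lawD (strike_dead _ deadB)).
- left; have safe0: ~~ (act && (node q == vb)).
    by rewrite safe_ne // -vb_q eq_sym nodeS_neq.
  apply: (solved_right (a := agent Back) _ vb_q).
  rewrite (round_stands (stands_strike CB safe0)) /=.
  by rewrite (meets_dead _ lawD (strike_dead _ deadF)).
Qed.

Lemma advance_step : advance_inv q C ->
  solved (round ids vb act C) \/ split_inv q (round ids vb act C).
Proof.
case=> [[CR CB CF CT] | [deadF CT vb_q] | [deadT CR CB vb_q1]].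
- have [/andP[hit /eqP vb_q1] | safe1] := boolP (act && (node q.+1 == vb)).
    right; apply: Or33; split=> //; first exact/round_dead/(dead_struck CB).
    have safe0: ~~ (act && (node q == vb)).
      by rewrite safe_ne // -vb_q1 eq_sym nodeS_neq.
    by rewrite /stands (round_stands (stands_strike CR safe0)).
  have DT := stands_strike CT safe1; have DF := stands_strike CF safe1.
  have CB' : stands (round ids vb act C) Back q Split.
    rewrite /stands (round_stands (stands_strike CB safe1)) /= (meets_alive DT).
    by rewrite /= ordSK.
  have CF' : stands (round ids vb act C) Fore q.+2 Split.
    by rewrite /stands (round_stands DF).
  have [/andP[hit /eqP vb_q] | safe0] := boolP (act && (node q == vb)).
    right; apply: Or32; split=> //.
    exact/round_dead/(dead_struck CR).
  right; apply: Or31; split=> //.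
    by rewrite /stands (round_stands (stands_strike CR safe0)).
  by rewrite /stands (round_stands DT) /= (meets_alive DF).
- left; have safe1: ~~ (act && (node q.+1 == vb)).
    by rewrite safe_ne // -vb_q nodeS_neq.
  apply: (solved_left (a := agent Front) (v := node q.+1)); last by rewrite -vb_q.
  rewrite (round_stands (stands_strike CT safe1)) /=.
  by rewrite (meets_dead _ lawD (strike_dead _ deadF)).
(* Back stands where Front died. If Back dies too, Rear will miss it at the next meeting; otherwise
   Back escapes to the right. *)
have [/andP[hit _] | safe1] := boolP (act && (node q.+1 == vb)).
  right; apply: Or33; split=> //; first exact/round_dead/(dead_struck CB).
  have safe0: ~~ (act && (node q == vb)).
    by rewrite safe_ne // -vb_q1 eq_sym nodeS_neq.
  by rewrite /stands (round_stands (stands_strike CR safe0)).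
left; apply: (solved_left (a := agent Back) (v := node q.+2)).
  rewrite (round_stands (stands_strike CB safe1)) /=.
  by rewrite (meets_dead _ lawD (strike_dead _ deadT)).
by rewrite -vb_q1.
Qed.

Lemma split_step : split_inv q C ->
  solved (round ids vb act C) \/ gather_inv q.+1 (round ids vb act C).
Proof.
have fore_step : stands C Fore q.+2 Split -> node q.+2 != vb ->
    stands (round ids vb act C) Fore q.+1 Gather.
  move=> CF /safe_ne safe2.
  by rewrite /stands (round_stands (stands_strike CF safe2)) /= ordSK.
case=> [[CR CB CF CT] | [deadR CB CF vb_q] | [deadB CR vb_q1]].
- have [/andP[hit /eqP vb_q] | safe0] := boolP (act && (node q == vb)).
    right; apply: Or32; split; last by rewrite -vb_q.
      exact/round_dead/(dead_struck CB).
    by apply: fore_step; rewrite // -vb_q nodeSS_neq.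
  have DR := stands_strike CR safe0; have DB := stands_strike CB safe0.
  have CB' : stands (round ids vb act C) Back q.+1 Gather.
    by rewrite /stands (round_stands DB) /= (meets_alive DR).
  have [/andP[hit /eqP vb_q2] | safe2] := boolP (act && (node q.+2 == vb)).
    right; apply: Or33; split=> //.
    exact/round_dead/(dead_struck CF).
  right; apply: Or31; split=> //.
  + by rewrite /stands (round_stands DR) /= (meets_alive DB).
  + by rewrite /stands (round_stands (stands_strike CF safe2)) /= ordSK.
  + by rewrite /stands (round_stands (stands_strike CT safe2)).
(* Back stands where Rear died. If Back dies too, Fore returns to [node q.+1] and will miss it
   there. *)
- have [/andP[hit _] | safe0] := boolP (act && (node q == vb)).
    right; apply: Or32; split; last by rewrite -vb_q.
      exact/round_dead/(dead_struck CB).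
    by apply: fore_step; rewrite // -vb_q nodeSS_neq.
  left; apply: (solved_left (a := agent Back) (v := node q.+1)).
    rewrite (round_stands (stands_strike CB safe0)) /=.
    by rewrite (meets_dead _ lawD (strike_dead _ deadR)).
  by rewrite -vb_q.
left; have safe0: ~~ (act && (node q == vb)).
  by rewrite safe_ne // -vb_q1 eq_sym nodeS_neq.
apply: (solved_right (a := agent Rear) _ vb_q1).
rewrite (round_stands (stands_strike CR safe0)) /=.
by rewrite (meets_dead _ lawD (strike_dead _ deadB)).
Qed.

End Rounds.

(** * Whole executions *)

Local Notation conf := (config_at explore ids home vb active).

(** Since [vb] is not [home], nobody dies in the first round and everyone sees all five
    identifiers. *)
Lemma conf1E a : conf 1 a
  = Some (dest home (if role_of a == Front then GoRight else Stay),
          enc (walking (role_of a) Gather)).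
Proof.
have conf0 b : strike vb (active 0) (conf 0) b = Some (home, enc (@start n)).
  by rewrite !ffunE /located ffunE eq_sym (negbTE vb_home) andbF.
have seen0 : ids_at ids (strike vb (active 0) (conf 0)) home
    = [set ids b | b in 'I_5].
  apply/setP=> i; apply/imsetP/imsetP=> -[b _ ->]; exists b => //.
  by rewrite inE /located conf0 eqxx.
rewrite -[conf 1]/(round ids vb (active 0) (conf 0)) ffunE conf0.
by rewrite /= stored_encode /= seen0.
Qed.

Lemma conf1_gather : gather_inv 0 (conf 1).
Proof. by apply: Or31; split; rewrite /stands conf1E agentK. Qed.

Lemma conf_lawful t : lawful (conf t.+1).
Proof.
elim: t => [|t IHt]; last exact: round_lawful.
move=> a v m; rewrite conf1E => -[_ <-].
by rewrite encodeK ?state_fits //; apply: eqxx.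
Qed.

(** The offset 1 in the round number is the initial round that assigns the roles. *)
Lemma conf_cycle q :
  (exists t, solved (conf t)) \/ gather_inv q (conf (q * 3).+1).
Proof.
elim: q => [|q [|IHq]]; first by right; apply: conf1_gather.
  by left.
have [|IH1] := gather_step (active (q * 3).+1) (@conf_lawful (q * 3)) IHq.
  by left; exists (q * 3).+2.
have [|IH2] := advance_step (active (q * 3).+2) (@conf_lawful (q * 3).+1) IH1.
  by left; exists (q * 3).+3.
have [|IH3] := split_step (active (q * 3).+3) (@conf_lawful (q * 3).+2) IH2.
  by left; exists (q * 3).+4.
by right.
Qed.

Lemma iter_ordS_reach (u v : 'I_n) : exists2 k, k < n & iter k (@ordS n) u = v.
Proof.
exists ((v + (n - u)) %% n); first exact: ltn_pmod.
apply: val_inj; apply: etrans (iter_ordSE _ _) _.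
rewrite modnDmr addnCA subnKC; last exact/ltnW/ltn_ord.
by rewrite modnDr modn_small.
Qed.

Lemma conf_patrols t a j : j < n.-1.*2 -> patrols (conf t) a j ->
  forall s, patrols (conf (t + s)) a ((j + s) %% n.-1.*2).
Proof.
move=> lt_j patrol_t; elim=> [|s IHs]; first by rewrite !addn0 modn_small.
have lt_s : (j + s) %% n.-1.*2 < n.-1.*2 by rewrite ltn_pmod; lia.
have := round_patrols (active (t + s)) lt_s IHs.
by rewrite !addnS -[(_ %% _).+1]addn1 modnDml addn1.
Qed.

Lemma explore_from_solved t v T : solved (conf t) -> v != vb ->
  exists2 u, T <= u & visited explore ids home vb active u v.
Proof.
case=> a [j [lt_j patrol_t]] v_vb.
have [[_ vb_v | i lt_in i_v]] := iter_ordS_reach vb v.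
  by rewrite -vb_v eqxx in v_vb.
have lt_i : i < n.-1 by [].
(* Finish the current period, let [T] more pass to get beyond round [T], then advance to index [i],
   whose offset is [i.+1]. *)
pose s := i + (n.-1.*2 - j) + T * n.-1.*2.
have s_i : (j + s) %% n.-1.*2 = i.
  have -> : j + s = T.+1 * n.-1.*2 + i by rewrite /s; nia.
  rewrite modnMDl modn_small //; lia.
exists (t + s); first by rewrite /s; nia.
exists a; rewrite /located (conf_patrols lt_j patrol_t s) s_i.
by rewrite /offset lt_i i_v.
Qed.

Lemma explore_ring v T : v != vb ->
  exists2 t, T <= t & visited explore ids home vb active t v.
Proof.
move=> v_vb; have [k _ k_v] := iter_ordS_reach home v.
(* [T] extra turns keep the node and delay the cycle beyond round [T]. *)
have node_k : node (k + T * n) = v.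
  apply: val_inj; apply: etrans (iter_ordSE _ _) _.
  by rewrite addnA addnC modnMDl -iter_ordSE k_v.
have [[t solved_t] | inv] := conf_cycle (k + T * n).
  exact: explore_from_solved solved_t v_vb.
exists ((k + T * n) * 3).+1; first by nia.
have at_v r p : stands (conf ((k + T * n) * 3).+1) r (k + T * n) p ->
    visited explore ids home vb active ((k + T * n) * 3).+1 v.
  by move=> stands_r; exists (agent r); rewrite /located stands_r node_k.
(* Every case of [gather_inv] has Back or Fore alive on the first node of the cycle. *)
by case: inv => [[_ /at_v] | [_ /at_v] | [_ /at_v]].
Qed.

(** Spare never moves, and the black hole is elsewhere. *)
Lemma explore_home t : visited explore ids home vb active t home.
Proof.
exists (agent Spare); case: t => [|t]; first by rewrite /located ffunE.
suff [p spare_t] : exists p, stands (conf t.+1) Spare 0 p.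
  by rewrite /located spare_t eqxx.
elim: t => [|t [p IHt]].
  by exists Gather; rewrite /stands conf1E agentK.
exists (next_phase p); rewrite /stands (round_stands (stands_strike IHt _)).
  by case: p {IHt}.
by rewrite eq_sym (negbTE vb_home) andbF.
Qed.

End Algorithm.

Theorem theorem9 (c : nat) :
  exists A : algorithm 5 c, log_memory A /\ solves_PerpExploration_BBH A.
Proof.
exists (explore c); split; first exact: explore_log_memory.
case=> [|n'] home vb ids active ids_inj vb_home v v_vb T; first by case: (home).
have [n_ge3 | n_le2] := ltnP 2 n'.+1; first exact: explore_ring.
(* On at most two nodes, only [home] remains besides [vb]. *)
suff -> : v = home by exists T; last exact: explore_home.
apply/eqP; apply: contraT => v_home.
move: v_vb vb_home v_home; rewrite -!val_eqE /=.
have := ltn_ord v; have := ltn_ord vb; have := ltn_ord home; lia.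
Qed.
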